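(* Let $q=2^e$ with $e\ge3$ odd, $\sigma=2^{\frac{e+1}{2}}$, and let $\varepsilon\in\mathbb{F}_{q^2}\setminus\mathbb{F}_q$ satisfy $\varepsilon^2+\varepsilon+\delta=0$ with $\delta\in\mathbb{F}_q\setminus\{1\}$, $\mathrm{Tr}_{q/2}(\delta)=1$. Let $\mathcal{H}^3_\varepsilon$ be the BT quasi-Hermitian variety of $\mathrm{PG}(3,q^2)$. Then the following hold: (1) each affine line contained in $\mathcal{H}^3_\varepsilon$ intersects $\ell_\infty$ at one among the points $L_\infty^{\varepsilon^q\alpha}=(0,1,1,\varepsilon^q\alpha)$, where $\alpha\in\mathbb{F}_q$; (2) through each point $L_\infty^{\varepsilon^q\alpha}$ ($\alpha\in\mathbb{F}_q$) there exist exactly $q+1$ coplanar lines contained in $\mathcal{H}^3_\varepsilon$, one of which is $\ell_\infty$. Each such set of $q+1$ lines forms a Hermitian cone $\Pi_0\mathcal{H}(1,q^2)$.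
   Context: Points of $\mathrm{PG}(3,q^2)$ have homogeneous coordinates $(X_0,X_1,X_2,X_3)$; $\Pi_\infty$ is the plane $X_0=0$, $\ell_\infty$ is the line $X_0=X_1+X_2=0$; affine coordinates are $x_i=X_i/X_0$. An affine line is a line of $\mathrm{PG}(3,q^2)$ not contained in $\Pi_\infty$, with its point at infinity included. In exponents, $\sigma$ denotes the integer $2^{(e+1)/2}$. $\mathrm{Tr}_{q/2}$ is the absolute trace of $\mathbb{F}_q$. Put $\Gamma_\varepsilon(x)=[x+(x^q+x)\varepsilon]^{\sigma+2}+(x^q+x)^\sigma+(x^{2q}+x^2)\varepsilon+x^{q+1}+x^2$. The BT quasi-Hermitian variety $\mathcal{H}^3_\varepsilon$ is the set consisting of the affine points $(x_1,x_2,x_3)\in\mathbb{F}_{q^2}^3$ with $x_3^q+x_3=\Gamma_\varepsilon(x_1)+\Gamma_\varepsilon(x_2)$, together with the points $(0,X_1,X_2,X_3)$ with $X_1^{q+1}+X_2^{q+1}=0$. A Hermitian cone $\Pi_0\mathcal{H}(1,q^2)$ in a plane is the join of a point $\Pi_0$ (the vertex) to a non-singular Hermitian variety $\mathcal{H}(1,q^2)$ (equivalently, a Baer subline, of $q+1$ points) of a line of that plane not through $\Pi_0$. *)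

(* Defs.v *)
From mathcomp Require Import all_boot all_order all_algebra all_field.

Set Implicit Arguments.
Unset Strict Implicit.
Unset Printing Implicit Defensive.

Import GRing.Theory.
Local Open Scope ring_scope.

(* F plays the role of the field with q^2 elements.  Its subfield with q
   elements is the set of fixed points of x |-> x ^+ q. *)
Definition in_Fq (F : finFieldType) (q : nat) (x : F) : Prop := x ^+ q = x.

(* The absolute trace of the subfield with 2 ^ e elements. *)
Definition abs_trace (F : finFieldType) (e : nat) (x : F) : F :=
  \sum_(i < e) x ^+ (2 ^ i).

(* PG(3, F): points, lines and planes are the subspaces of F^4 of vector
   dimension 1, 2 and 3; incidence is inclusion. *)
Definition coords (F : finFieldType) (X0 X1 X2 X3 : F) : 'rV[F]_4 :=
  \row_(i < 4) [:: X0; X1; X2; X3]`_i.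

Definition pt (F : finFieldType) (X0 X1 X2 X3 : F) : {vspace 'rV[F]_4} :=
  <[coords X0 X1 X2 X3]>%VS.

Definition pg_point (F : finFieldType) (P : {vspace 'rV[F]_4}) : Prop :=
  \dim P = 1%N.
Definition pg_line (F : finFieldType) (l : {vspace 'rV[F]_4}) : Prop :=
  \dim l = 2%N.
Definition pg_plane (F : finFieldType) (p : {vspace 'rV[F]_4}) : Prop :=
  \dim p = 3%N.

(* The plane a0 X0 + a1 X1 + a2 X2 + a3 X3 = 0. *)
Definition hyperplane (F : finFieldType) (a0 a1 a2 a3 : F) :
    {vspace 'rV[F]_4} :=
  lker (linfun (mulmxr (coords a0 a1 a2 a3)^T)).

Definition Pi_inf (F : finFieldType) : {vspace 'rV[F]_4} :=
  hyperplane 1 0 0 0.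
Definition l_inf (F : finFieldType) : {vspace 'rV[F]_4} :=
  (Pi_inf F :&: (hyperplane 0 1 1 0)%R)%VS.

Definition affine_line (F : finFieldType) (l : {vspace 'rV[F]_4}) : Prop :=
  pg_line l /\ ~ (l <= Pi_inf F)%VS.

Definition pointset (F : finFieldType) := {vspace 'rV[F]_4} -> Prop.

Definition contained_in (F : finFieldType) (l : {vspace 'rV[F]_4})
    (S : pointset F) : Prop :=
  forall P : {vspace 'rV[F]_4}, pg_point P -> (P <= l)%VS -> S P.

Definition Gamma (F : finFieldType) (q sigma : nat) (eps x : F) : F :=
  (x + (x ^+ q + x) * eps) ^+ (sigma + 2) + (x ^+ q + x) ^+ sigma
  + (x ^+ (2 * q) + x ^+ 2) * eps + x ^+ (q + 1) + x ^+ 2.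

Definition BT_quasi_hermitian (F : finFieldType) (q sigma : nat) (eps : F) :
    pointset F := fun P =>
  (exists x1 x2 x3 : F,
      P = pt 1 x1 x2 x3
      /\ x3 ^+ q + x3 = Gamma q sigma eps x1 + Gamma q sigma eps x2)
  \/ (exists X1 X2 X3 : F,
      [/\ coords 0 X1 X2 X3 != 0,
          P = pt 0 X1 X2 X3
        & X1 ^+ (q + 1) + X2 ^+ (q + 1) = 0]).

(* B is a non-singular Hermitian variety H(1,q^2) of the line m: for some
   coordinate system on m, given by a basis (the rows of M), B is the set of
   points whose coordinate vector u satisfies u H (u^q)^T = 0, where H is an
   invertible matrix equal to its conjugate transpose. *)
Definition hermitian_variety1 (F : finFieldType) (q : nat)
    (m : {vspace 'rV[F]_4}) (B : pointset F) : Prop :=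
  exists (M : 'M[F]_(2, 4)) (H : 'M[F]_2),
    [/\ basis_of m [:: row 0 M; row 1 M],
        H \is hermitianmx 2 false (fun x : F => x ^+ q),
        H \in unitmx
      & forall P : {vspace 'rV[F]_4},
          B P <-> exists u : 'rV[F]_2,
            [/\ u != 0, P = <[u *m M]>%VS
              & u *m H *m (map_mx (fun x : F => x ^+ q) u)^T = 0]].

Definition hermitian_cone (F : finFieldType) (q : nat)
    (p V : {vspace 'rV[F]_4}) (C : pointset F) : Prop :=
  [/\ pg_plane p, pg_point V, (V <= p)%VS
    & exists (m : {vspace 'rV[F]_4}) (B : pointset F),
      [/\ pg_line m, (m <= p)%VS, ~ (V <= m)%VS,
          hermitian_variety1 q m B
        & forall P : {vspace 'rV[F]_4}, pg_point P ->
            (C P <-> exists b : {vspace 'rV[F]_4},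
                       B b /\ (P <= V + b)%VS)]].

Definition points_on (F : finFieldType) (s : seq {vspace 'rV[F]_4}) :
    pointset F := fun P =>
  pg_point P /\ exists l : {vspace 'rV[F]_4}, l \in s /\ (P <= l)%VS.

Definition L_inf (F : finFieldType) (a : F) : {vspace 'rV[F]_4} :=
  pt 0 1 1 a.

(* Main.v *)
Require Import Defs.
From mathcomp Require Import all_boot all_order all_algebra all_field.
From mathcomp Require Import ring zify.
Import GRing.Theory.
Local Open Scope ring_scope.

(** Write x = a + b eps with a, b in the subfield Fq of q elements.  Since
    eps ^ q = eps + 1, the function Gamma collapses to the Tits form
    G a b = a ^ (sigma + 2) + b ^ sigma + a b, which takes values in Fq
    ([Gamma_coords]), and b is the relative trace x ^ q + x.

    An affine line of the variety has a direction (0, m1, m2, m3) at infinity,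
    with m1 and m2 of equal norm.  Both are nonzero, for otherwise X3 alone
    would vary along the line, and its trace with it.  So the line can be
    reparametrised as t |-> (1, t, x2 + t w, y + t m), and being contained in
    the variety says that
      tr (y + t m) = Gamma t + Gamma (x2 + t w)   for all t.
    With w = c + d eps and x2 = a + b eps, restricting t to Fq and to Fq eps
    gives two polynomial identities on Fq in the monomials 1, X, X ^ 2,
    X ^ sigma and X ^ (sigma + 2).  As 2 < sigma and sigma + 2 < q, all their
    coefficients vanish ([sparse_poly_eq0]).  The leading one of the first
    gives c ^ (sigma + 2) = 1, hence c = 1 because sigma ^ 2 acts on Fq as
    squaring; the leading one of the second gives d delta = 0, hence d = 0;
    then a ^ sigma = d gives a = 0, and the others give m = eps ^ q b and
    tr y = b ^ sigma ([normalised_line]).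

    So the affine lines of the variety are exactly the joins [cone_line b y] of
    (0, 1, 1, eps ^ q b) and (1, 0, b eps, y), with b in Fq and
    tr y = b ^ sigma.  For a fixed b there are q such y.  The only line at
    infinity through (0, 1, 1, eps ^ q b) inside the variety is l_inf, as every
    other one has a point where the norms of X1 and X2 differ
    ([inf_line_BT]).  The q + 1 lines all meet the line spanned by
    (1, 0, b eps, 0) and (0, 0, 0, 1), in the points whose coordinates (u0, u1)
    there satisfy
      b ^ sigma u0 ^ (q + 1) + u1 u0 ^ q + u0 u1 ^ q = 0,
    and this is a non-singular Hermitian form ([base_hermitian]). *)

(** * Coordinates in PG(3, F) *)

Section Coordinates.

Context {F : finFieldType}.
Implicit Types (l P : {vspace 'rV[F]_4}) (u v w : 'rV[F]_4).

Lemma coordsD (a b c d a' b' c' d' : F) :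
  coords a b c d + coords a' b' c' d' = coords (a + a') (b + b') (c + c') (d + d').
Proof. by apply/rowP => i; rewrite !mxE; case: i => [[|[|[|[|i]]]] hi]. Qed.

Lemma coordsZ (k a b c d : F) :
  k *: coords a b c d = coords (k * a) (k * b) (k * c) (k * d).
Proof. by apply/rowP => i; rewrite !mxE; case: i => [[|[|[|[|i]]]] hi]. Qed.

Lemma coords0 : coords 0 0 0 0 = 0 :> 'rV[F]_4.
Proof. by apply/rowP => i; rewrite !mxE; case: i => [[|[|[|[|i]]]] hi]. Qed.

Lemma coords_inj (a b c d a' b' c' d' : F) :
  coords a b c d = coords a' b' c' d' -> [/\ a = a', b = b', c = c' & d = d'].
Proof.
move=> /rowP h; have h0 := h 0; have h1 := h 1; have h2 := h (inord 2).
have h3 := h (inord 3); move: h0 h1 h2 h3.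
by rewrite !mxE !inordK.
Qed.

Lemma vec_coords v : exists a b c d, v = coords a b c d.
Proof.
exists (v 0 0), (v 0 1), (v 0 (inord 2)), (v 0 (inord 3)).
by apply/rowP => i; rewrite !mxE; case: i => [[|[|[|[|i]]]] hi] //=;
  congr (v _ _); apply: val_inj => //=; rewrite ?inordK.
Qed.

Lemma mem_hyperplane (a b c d x0 x1 x2 x3 : F) :
  (coords x0 x1 x2 x3 \in hyperplane a b c d)
  = (a * x0 + b * x1 + c * x2 + d * x3 == 0).
Proof.
rewrite memv_ker lfunE /=; apply/eqP/eqP => [/matrixP/(_ 0 0) | h].
  rewrite !mxE !big_ord_recl big_ord0 !mxE /= => h; rewrite -[RHS]h; ring.
apply/matrixP => i j; rewrite !ord1 !mxE !big_ord_recl big_ord0 !mxE /= -[RHS]h.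
ring.
Qed.

Lemma mem_pt (a b c d : F) v :
  reflect (exists k, v = coords (k * a) (k * b) (k * c) (k * d)) (v \in pt a b c d).
Proof.
by apply: (iffP (vlineP _ _)) => -[k ->]; exists k; rewrite coordsZ.
Qed.

Lemma pg_pointP P : pg_point P <-> exists2 v, v != 0 & P = <[v]>%VS.
Proof.
split=> [dP | [v v0 ->]]; last by rewrite /pg_point dim_vline v0.
have P0 : P != 0%VS by rewrite -dimv_eq0 dP.
exists (vpick P); first by rewrite vpick0.
by apply/esym/eqP; rewrite eqEdim -memvE memv_pick dim_vline vpick0 P0 dP.
Qed.

Lemma contained_inE l (S : pointset F) :
  contained_in l S <-> forall v, v \in l -> v != 0 -> S <[v]>%VS.
Proof.
split=> [h v vl v0 | h P /pg_pointP[v v0 ->]]; last by rewrite -memvE => /h; exact.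
by apply: h => //; apply/pg_pointP; exists v.
Qed.

Lemma dim_add_vline v (U : {vspace 'rV[F]_4}) :
  v \notin U -> \dim (<[v]> + U) = (\dim U).+1.
Proof.
move=> vU; rewrite dimv_disjoint_sum.
  by rewrite dim_vline; case: eqP vU => // ->; rewrite mem0v.
apply/eqP; rewrite -subv0; apply/subvP => _ /memv_capP[/vlineP[k ->] kvU].
rewrite memv0 scaler_eq0; apply: contraNT vU; rewrite negb_or => /andP[k0 _].
by rewrite -(scalerK k0 v) memvZ.
Qed.

Lemma dim_span2 u v : v != 0 -> u \notin <[v]>%VS -> \dim (<[u]> + <[v]>) = 2%N.
Proof. by move=> v0 uv; rewrite dim_add_vline // dim_vline v0. Qed.

Lemma vlineZ (k : F) v : k != 0 -> <[k *: v]>%VS = <[v]>%VS.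
Proof.
move=> k0; apply/eqP; rewrite eqEsubv -!memvE memvZ ?memv_line //.
by rewrite -{1}(scalerK k0 v) memvZ // memv_line.
Qed.

Lemma line_span l u v : pg_line l -> u \in l -> v \in l -> v != 0 ->
  u \notin <[v]>%VS -> l = (<[u]> + <[v]>)%VS.
Proof.
move=> dl ul vl v0 uv; apply/esym/eqP.
by rewrite eqEdim dim_span2 // dl leqnn subv_add -!memvE ul vl.
Qed.

Lemma line_other_point l v : pg_line l -> exists2 u, u \in l & u \notin <[v]>%VS.
Proof.
move=> dl; apply/subvPn/negP => /dimvS.
by rewrite dl dim_vline; case: (_ != _).
Qed.

Lemma mem_Pi_inf (x0 x1 x2 x3 : F) : (coords x0 x1 x2 x3 \in Pi_inf F) = (x0 == 0).
Proof. by rewrite mem_hyperplane mul1r !mul0r !addr0. Qed.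

Lemma mem_l_inf (x0 x1 x2 x3 : F) :
  (coords x0 x1 x2 x3 \in l_inf F) = (x0 == 0) && (x1 + x2 == 0).
Proof.
by rewrite memv_cap mem_Pi_inf mem_hyperplane !mul1r !mul0r add0r addr0.
Qed.

Lemma mem_join_pt (a b c d a' b' c' d' : F) v :
  reflect (exists s t, v = coords (s * a + t * a') (s * b + t * b')
                                  (s * c + t * c') (s * d + t * d'))
          (v \in (pt a b c d + pt a' b' c' d')%VS).
Proof.
apply: (iffP memv_addP) => [[_ /mem_pt[s ->] [_ /mem_pt[t ->] ->]] | [s [t ->]]].
  by exists s, t; rewrite coordsD.
exists (coords (s * a) (s * b) (s * c) (s * d)); first by apply/mem_pt; exists s.
exists (coords (t * a') (t * b') (t * c') (t * d')); last by rewrite coordsD.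
by apply/mem_pt; exists t.
Qed.

End Coordinates.
(** * The field of order q ^ 2 as a quadratic extension *)

Section Field.

Context (F : finFieldType) (e q sigma : nat) (eps delta : F).
Context (he3 : (3 <= e)%N) (he_odd : odd e).
Context (hq : q = (2 ^ e)%N) (hsigma : sigma = (2 ^ ((e + 1) %/ 2))%N).
Context (hF : #|F| = (q ^ 2)%N).
Context (heps : ~ in_Fq q eps) (heps_eq : eps ^+ 2 + eps + delta = 0).
Context (hdelta : in_Fq q delta).

Notation Fq := (@in_Fq F q).
Notation tr x := (x ^+ q + x).

Lemma sigma_bounds : (2 < sigma)%N /\ (sigma + 2 < q)%N.
Proof.
have [k ek] : exists k, e = k.+1.*2.+1.
  by exists e./2.-1; have := odd_double_half e; rewrite he_odd; lia.
have sE : sigma = (4 * 2 ^ k)%N.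
  by rewrite hsigma (_ : (e + 1) %/ 2 = 2 + k)%N ?expnD //; lia.
have qE : q = (8 * (2 ^ k * 2 ^ k))%N.
  by rewrite hq (_ : e = 3 + (k + k))%N ?expnD //; lia.
have : (0 < 2 ^ k)%N by rewrite expn_gt0.
by rewrite sE qE; nia.
Qed.

Lemma sigma_sqr : (sigma * sigma = 2 * q)%N.
Proof.
rewrite hsigma hq -expnD -expnS; congr (_ ^ _)%N.
by have := odd_double_half e; rewrite he_odd; lia.
Qed.

Lemma pchar2 : 2%N \in [pchar F].
Proof. by apply: (@card_finPcharP F 2 (e * 2)); rewrite // hF hq expnM. Qed.

(** Reduces an equality in characteristic 2 to a polynomial identity over the
    integers, the witness [c] collecting the terms that occur twice. *)
Lemma eq_char2 (a b c : F) : a = b + 2 * c -> a = b.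
Proof. by move->; rewrite (pcharf0 pchar2) mul0r addr0. Qed.

Lemma addr_eq0_char2 (a b : F) : a + b = 0 -> a = b.
Proof. by move/eqP; rewrite addr_eq0 oppr_pchar2 ?pchar2 // => /eqP. Qed.

Lemma expr_pow2D n (x y : F) : (x + y) ^+ (2 ^ n) = x ^+ (2 ^ n) + y ^+ (2 ^ n).
Proof.
apply: exprDn_pchar; rewrite pnatX; apply/orP; left.
by rewrite pnatE // pchar2.
Qed.

Lemma expr_qD (x y : F) : (x + y) ^+ q = x ^+ q + y ^+ q.
Proof. by rewrite hq expr_pow2D. Qed.

Lemma expr_sD (x y : F) : (x + y) ^+ sigma = x ^+ sigma + y ^+ sigma.
Proof. by rewrite hsigma expr_pow2D. Qed.

Lemma expr_qK (x : F) : x ^+ q ^+ q = x.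
Proof. by rewrite -exprM mulnn -hF expf_card. Qed.

Lemma q_gt0 : (0 < q)%N. Proof. by rewrite hq expn_gt0. Qed.
Lemma sigma_gt0 : (0 < sigma)%N. Proof. by rewrite hsigma expn_gt0. Qed.

Lemma Fq0 : Fq 0. Proof. by rewrite /in_Fq expr0n eqn0Ngt q_gt0. Qed.
Lemma Fq1 : Fq 1. Proof. exact: expr1n. Qed.
Lemma FqD x y : Fq x -> Fq y -> Fq (x + y).
Proof. by rewrite /in_Fq expr_qD => -> ->. Qed.
Lemma FqM x y : Fq x -> Fq y -> Fq (x * y).
Proof. by rewrite /in_Fq exprMn => -> ->. Qed.
Lemma FqX x n : Fq x -> Fq (x ^+ n).
Proof. by rewrite /in_Fq exprAC => ->. Qed.
Lemma Fq_tr x : Fq (tr x).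
Proof. by rewrite /in_Fq expr_qD expr_qK addrC. Qed.

(** On Fq, sigma is the square root of the Frobenius map that defines the Suzuki
    groups: sigma * sigma = 2 q, and raising to the power q is trivial. *)
Lemma expr_ss x : Fq x -> x ^+ sigma ^+ sigma = x ^+ 2.
Proof. by move=> hx; rewrite -exprM sigma_sqr mulnC exprM hx. Qed.

Lemma eps_sqr : eps ^+ 2 = eps + delta.
Proof. by apply: addr_eq0_char2; rewrite addrA. Qed.

(** The conjugate of eps is the other root eps + 1 of X ^ 2 + X + delta:
    tr eps is a root of X ^ 2 + X, and it is nonzero because eps is not in Fq. *)
Lemma eps_q : eps ^+ q = eps + 1.
Proof.
have hy : tr eps * (tr eps + 1) = 0.
  have h : eps ^+ q ^+ 2 = eps ^+ q + delta.
    by rewrite exprAC eps_sqr expr_qD hdelta.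
  apply: (eq_char2 _ _ (eps ^+ q + eps + eps * eps ^+ q + delta)).
  transitivity (eps ^+ q ^+ 2 + eps ^+ 2 + eps ^+ q + eps + 2 * (eps * eps ^+ q)).
    by ring.
  by rewrite h eps_sqr; ring.
move/eqP: hy; rewrite mulf_eq0 => /orP[]/eqP/addr_eq0_char2; first by move/heps.
by move=> <-; apply: (eq_char2 _ _ (- eps)); ring.
Qed.

Lemma tr_add (x y : F) : tr (x + y) = tr x + tr y.
Proof. by rewrite expr_qD; ring. Qed.

Lemma tr_scale a x : Fq a -> tr (a * x) = a * tr x.
Proof. by move=> ha; rewrite exprMn ha; ring. Qed.

Lemma tr_Fq a : Fq a -> tr a = 0.
Proof. by move=> ->; rewrite (addrr_pchar2 pchar2). Qed.

Lemma tr_coords a b : Fq a -> Fq b -> tr (a + b * eps) = b.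
Proof.
move=> ha hb; rewrite tr_add tr_Fq // tr_scale // eps_q add0r.
by apply: (eq_char2 _ _ (b * eps)); ring.
Qed.

Lemma coordsP x : exists a b, [/\ Fq a, Fq b & x = a + b * eps].
Proof.
exists (x + tr x * eps), (tr x); split; last 2 first.
- exact: Fq_tr.
- by apply: (eq_char2 _ _ (- (tr x * eps))); ring.
rewrite /in_Fq expr_qD exprMn Fq_tr eps_q.
by apply: (eq_char2 _ _ (x ^+ q)); ring.
Qed.

(** The function whose graph is the affine part of the Suzuki-Tits ovoid. *)
Definition Tits a b : F := a ^+ (sigma + 2) + b ^+ sigma + a * b.

Lemma Gamma_coords a b : Fq a -> Fq b ->
  Gamma q sigma eps (a + b * eps) = Tits a b.
Proof.
move=> ha hb; have hx : tr (a + b * eps) = b by exact: tr_coords.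
have hxq : (a + b * eps) ^+ q = a + b * (eps + 1).
  by rewrite expr_qD exprMn ha hb eps_q.
rewrite /Gamma hx (mulnC 2) exprM (exprD _ q 1) expr1 hxq.
have -> : a + b * eps + b * eps = a.
  by apply: (eq_char2 _ _ (b * eps)); ring.
set X := a + b * eps.
apply: (eq_char2 _ _ ((X ^+ 2 + b * X) * eps + X ^+ 2 + b ^+ 2 * eps)).
rewrite /Tits.
rewrite /X; set P := a ^+ (_ + _); set Q := b ^+ sigma.
ring.
Qed.


(** The coordinates on the basis 1, eps put F in bijection with Fq x Fq, so
    that #|Fq| ^ 2 = q ^ 2. *)
Lemma card_Fq : #|[pred x : F | x ^+ q == x]| = q.
Proof.
set A := [pred x : F | _].
have Aq a : a \in A -> Fq a by move/eqP.
have cardF : #|[predX A & A]| = #|F|.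
  pose f (ab : F * F) := ab.1 + ab.2 * eps.
  have f_inj : {in [predX A & A] &, injective f}.
    move=> [a b] [a' b'] /andP[/= /Aq ha /Aq hb] /andP[/= /Aq ha' /Aq hb'] E.
    have eb : b = b'.
      by rewrite -(tr_coords a b ha hb) -(tr_coords a' b' ha' hb') [a + _]E.
    by move: E; rewrite /f /= eb => /addIr ->.
  rewrite -(card_in_image f_inj); apply: eq_card => x.
  have [a [b [ha hb ->]]] := coordsP x; rewrite [RHS]inE.
  by apply/imageP; exists (a, b); rewrite // inE /= !inE; apply/andP; split; apply/eqP.
by move/eqP: cardF; rewrite cardX hF mulnn eqn_sqr => /eqP.
Qed.

(** The fibre over [c] is the coset Fq + c eps. *)
Lemma card_tr_fibre c : Fq c -> #|[pred x : F | tr x == c]| = q.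
Proof.
move=> hc; rewrite -[RHS]card_Fq -[RHS](card_image (addIr (c * eps))).
apply: eq_card => x; rewrite inE; apply/eqP/imageP => [hx | [a /eqP ha ->]].
  exists (x + c * eps); last first.
    by apply: (eq_char2 _ _ (- (c * eps))); ring.
  rewrite inE; apply/eqP/addr_eq0_char2.
  rewrite tr_add tr_scale // eps_q hx.
  by apply: (eq_char2 _ _ (c + c * eps)); ring.
exact: tr_coords.
Qed.

(** The polynomial with these coefficients has degree at most sigma + 2 < q and
    the q elements of Fq as roots; the exponents 0, 1, 2, sigma and sigma + 2
    are distinct. *)
Lemma sparse_poly_eq0 (k0 k1 k2 ks kt : F) :
    (forall u, Fq u ->
       k0 + k1 * u + k2 * u ^+ 2 + ks * u ^+ sigma + kt * u ^+ (sigma + 2) = 0) ->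
  [/\ k0 = 0, k1 = 0, k2 = 0, ks = 0 & kt = 0].
Proof.
move=> H; have [s_gt2 s_ltq] := sigma_bounds.
pose p : {poly F} := k0%:P + k1 *: 'X + k2 *: 'X^2 + ks *: 'X^sigma
                     + kt *: 'X^(sigma + 2).
have p0 : p = 0.
  apply/eqP; apply: contraTT (leqnn q) => p_neq0; rewrite -ltnNge.
  have sz_p : (size p <= q)%N.
    apply/leq_sizeP => i hi; rewrite !coefE.
    by do !(case: eqP => [?|_]; first lia); rewrite !mulr0 !addr0.
  apply: leq_trans sz_p; rewrite -[X in (X < _)%N]card_Fq cardE.
  apply: max_poly_roots p_neq0 _ (enum_uniq _); apply/allP => u.
  rewrite mem_enum => /eqP /H hu. rewrite /root /p !hornerE.
  by rewrite expr2 mulrA in hu; apply/eqP.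
have c i : p`_i = 0 by rewrite p0 coef0.
have pE i : k0 *+ (i == 0)%N + k1 *+ (i == 1)%N + k2 *+ (i == 2)%N
            + ks *+ (i == sigma) + kt *+ (i == sigma + 2)%N = 0.
  by rewrite -(c i) !coefE !mulr_natr; case: eqP.
split; [have := pE 0 | have := pE 1 | have := pE 2%N
       | have := pE sigma | have := pE (sigma + 2)%N].
all: by do 5 (case: eqP => ?; try lia); rewrite ?add0r ?addr0.
Qed.

(** Raising c ^ (sigma + 2) = 1 to the power sigma gives
    (c ^ (sigma + 1)) ^ 2 = 1, so both c ^ (sigma + 1) and c ^ (sigma + 2) are 1. *)
Lemma expr_sigma2_eq1 c : Fq c -> c ^+ (sigma + 2) = 1 -> c = 1.
Proof.
move=> hc hc1.
have hs : c ^+ (sigma + 1) = 1.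
  have /eqP : (c ^+ (sigma + 1)) ^+ 2 = 1.
    rewrite -[RHS](expr1n _ sigma) -hc1 !exprD !exprMn expr_ss // expr1.
    by rewrite mulrC [c ^+ sigma ^+ 2]expr2.
  by rewrite sqrf_eq1 (oppr_pchar2 pchar2) orbb => /eqP.
by rewrite -hc1 (_ : sigma + 2 = (sigma + 1).+1)%N ?exprS ?hs ?mulr1 //; lia.
Qed.

Lemma Tits_affine a b c d u :
  Tits (a + c * u) (b + d * u) =
    Tits a b + (a * d + b * c) * u + (a ^+ sigma * c ^+ 2 + c * d) * u ^+ 2
    + (c ^+ sigma * a ^+ 2 + d ^+ sigma) * u ^+ sigma
    + c ^+ (sigma + 2) * u ^+ (sigma + 2).
Proof.
rewrite /Tits !exprD !expr_sD !exprMn.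
set as_ := a ^+ sigma; set cs := c ^+ sigma; set us := u ^+ sigma.
set bs := b ^+ sigma; set ds := d ^+ sigma.
apply: (eq_char2 _ _ ((as_ + cs * us) * a * c * u)).
by ring.
Qed.

Lemma Tits0l b : Tits 0 b = b ^+ sigma.
Proof. by rewrite /Tits addn2 exprS !mul0r add0r addr0. Qed.

Lemma Tits0r a : Tits a 0 = a ^+ (sigma + 2).
Proof. by rewrite /Tits mulr0 expr0n eqn0Ngt sigma_gt0 !addr0. Qed.

Lemma delta_neq0 : delta != 0.
Proof.
apply/eqP => d0; apply: heps; have /eqP := eps_sqr.
rewrite d0 addr0 expr2 -[X in _ == X]mulr1 -subr_eq0 -mulrBr mulf_eq0 subr_eq0.
by case/orP => /eqP ->; [exact: Fq0 | exact: Fq1].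
Qed.

(** The coefficients of the conditions at t = u and t = v eps, for u, v in Fq,
    determine all parameters of the line. *)
Lemma normalised_line x2 y w m :
    (forall t, tr (y + t * m) =
       Gamma q sigma eps t + Gamma q sigma eps (x2 + t * w)) ->
  exists b, [/\ Fq b, w = 1, x2 = b * eps, m = eps ^+ q * b
              & tr y = b ^+ sigma].
Proof.
have [a [b [ha hb ->]]] := coordsP x2.
have [c [d [hc hd ->]]] := coordsP w.
have [m0 [m1 [hm0 hm1 em]]] := coordsP m.
move=> H.
(* The condition for t = u in Fq. *)
have [k0 k1 k2 _ kt] : [/\ tr y + Tits a b = 0, tr m + (a * d + b * c) = 0,
    a ^+ sigma * c ^+ 2 + c * d = 0, c ^+ sigma * a ^+ 2 + d ^+ sigma = 0
    & 1 + c ^+ (sigma + 2) = 0].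
  apply: sparse_poly_eq0 => u hu; have := H u.
  have -> : a + b * eps + u * (c + d * eps) = a + c * u + (b + d * u) * eps by ring.
  have Gu := Gamma_coords u 0 hu Fq0; rewrite mul0r addr0 Tits0r in Gu.
  rewrite {}Gu Gamma_coords; try by do ?[apply: FqD | apply: FqM].
  rewrite Tits_affine tr_add tr_scale // => E.
  apply: (eq_char2 _ _ (tr y + u * tr m)).
  by rewrite add0r mulr_natl mulr2n {2}E; ring.
have hdd : Fq (d * delta) by exact: FqM.
have hcd : Fq (c + d) by exact: FqD.
(* The condition for t = v eps with v in Fq. *)
have [_ k1' _ _ kt'] : [/\ tr y + Tits a b = 0,
    tr (eps * m) + (a * (c + d) + b * (d * delta)) + 0 = 0,
    a ^+ sigma * (d * delta) ^+ 2 + d * delta * (c + d) = 0,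
    1 + ((d * delta) ^+ sigma * a ^+ 2 + (c + d) ^+ sigma) = 0
    & (d * delta) ^+ (sigma + 2) = 0].
  apply: sparse_poly_eq0 => v hv; have := H (v * eps).
  have -> : a + b * eps + v * eps * (c + d * eps)
            = a + d * delta * v + (b + (c + d) * v) * eps.
    transitivity (a + b * eps + v * c * eps + v * d * eps ^+ 2); first by ring.
    by rewrite eps_sqr; ring.
  have Gv := Gamma_coords 0 v Fq0 hv; rewrite add0r Tits0l in Gv.
  rewrite {}Gv Gamma_coords; try by do ?[apply: FqD | apply: FqM].
  rewrite Tits_affine tr_add -mulrA tr_scale // => E.
  apply: (eq_char2 _ _ (tr y + v * tr (eps * m))).
  by rewrite add0r mulr_natl mulr2n {2}E; ring.
have d0 : d = 0.
  by move/eqP: kt'; rewrite expf_eq0 mulf_eq0 (negPf delta_neq0) orbF => /andP[_ /eqP].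
have c1 : c = 1 by apply: expr_sigma2_eq1 => //; rewrite -(addr_eq0_char2 _ _ kt).
have a0 : a = 0.
  by move/eqP: k2; rewrite d0 c1 expr1n mulr1 mulr0 addr0 expf_eq0 => /andP[_ /eqP].
exists b; split => //.
- by rewrite c1 d0 mul0r addr0.
- by rewrite a0 add0r.
- move: k1 k1'; rewrite em a0 d0 c1 !mul0r mulr0 add0r mulr1 !addr0.
  have -> : eps * (m0 + m1 * eps) = m1 * delta + (m0 + m1) * eps.
    transitivity (m0 * eps + m1 * eps ^+ 2); first by ring.
    by rewrite eps_sqr; ring.
  rewrite !tr_coords //; do ?[exact: FqD | exact: FqM].
  move=> /addr_eq0_char2 -> /addr_eq0_char2 ->.
  by rewrite eps_q; ring.
- by apply: addr_eq0_char2; rewrite -Tits0l -[X in Tits X]a0.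
Qed.


(** * Lines contained in the BT quasi-Hermitian variety *)

Notation BT := (@BT_quasi_hermitian F q sigma eps).

Lemma BT_affine_pt x1 x2 x3 :
  BT (pt 1 x1 x2 x3) <-> tr x3 = Gamma q sigma eps x1 + Gamma q sigma eps x2.
Proof.
split=> [|h]; last by left; exists x1, x2, x3.
case=> [[y1 [y2 [y3 [E h]]]] | [y1 [y2 [y3 [_ E _]]]]].
  have /mem_pt[k /coords_inj[k1 -> -> ->]] : coords 1 x1 x2 x3 \in pt 1 y1 y2 y3.
    by rewrite -E memv_line.
  by rewrite mulr1 in k1; rewrite -k1 !mul1r.
have /mem_pt[k /coords_inj[/eqP]] : coords 1 x1 x2 x3 \in pt 0 y1 y2 y3.
  by rewrite -E memv_line.
by rewrite mulr0 oner_eq0.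
Qed.

Lemma BT_inf_pt (x1 x2 x3 : F) : coords 0 x1 x2 x3 != 0 ->
  BT (pt 0 x1 x2 x3) <-> x1 ^+ (q + 1) = x2 ^+ (q + 1).
Proof.
move=> nz; split=> [|h].
  case=> [[y1 [y2 [y3 [E _]]]] | [y1 [y2 [y3 [_ E /addr_eq0_char2 h]]]]].
    have /mem_pt[k /coords_inj[/eqP]] : coords 1 y1 y2 y3 \in pt 0 x1 x2 x3.
      by rewrite E memv_line.
    by rewrite mulr0 oner_eq0.
  have /mem_pt[k /coords_inj[_ -> -> _]] : coords 0 x1 x2 x3 \in pt 0 y1 y2 y3.
    by rewrite -E memv_line.
  by rewrite !exprMn h.
by right; exists x1, x2, x3; split; rewrite // h (addrr_pchar2 pchar2).
Qed.

Lemma eps_neq0 : eps != 0.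
Proof. by apply/eqP => e0; apply: heps; rewrite e0; exact: Fq0. Qed.

(** The converse of [normalised_line]: in the coordinates t = u + v eps the
    Tits forms at (u, v) and (u, b + v) differ by b ^ sigma + u b only. *)
Lemma tr_along_cone_line (x t : F) b : Fq b -> tr x = b ^+ sigma ->
  tr (x + t * (eps ^+ q * b)) = Gamma q sigma eps t + Gamma q sigma eps (b * eps + t).
Proof.
move=> hb hx; have [u [v [hu hv ->]]] := coordsP t.
have -> : b * eps + (u + v * eps) = u + (b + v) * eps by ring.
have -> : (u + v * eps) * (eps ^+ q * b) = b * ((u + v * delta) + u * eps).
  rewrite eps_q; apply: (eq_char2 _ _ (b * v * eps)).
  transitivity (b * (u * eps + u + v * eps ^+ 2 + v * eps)); first by ring.
  by rewrite eps_sqr; ring.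
rewrite tr_add tr_scale // tr_coords //; try by apply: FqD => //; exact: FqM.
rewrite !Gamma_coords //; try exact: FqD.
rewrite hx /Tits expr_sD.
apply: (eq_char2 _ _ (- (u ^+ (sigma + 2) + v ^+ sigma + u * v))).
by ring.
Qed.

Definition cone_line (b y : F) : {vspace 'rV[F]_4} :=
  ((L_inf (eps ^+ q * b))%R + (pt 1 0 (b * eps) y)%R)%VS.

Lemma mem_cone_line b y v :
  reflect (exists s t, v = coords t s (s + t * (b * eps)) (s * (eps ^+ q * b) + t * y))
          (v \in cone_line b y).
Proof.
by apply: (iffP (mem_join_pt _ _ _ _ _ _ _ _ _)) => -[s [t ->]]; exists s, t;
  rewrite !(mulr0, mulr1, add0r, addr0).
Qed.

Lemma cone_line_BT b y : Fq b -> tr y = b ^+ sigma -> contained_in (cone_line b y) BT.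
Proof.
move=> hb hy; apply/contained_inE => v /mem_cone_line[s [t ->]] v0.
have [t0 | t0] := eqVneq t 0.
  by move: v0; rewrite t0 mul0r addr0 => v0; apply/BT_inf_pt.
have -> : coords t s (s + t * (b * eps)) (s * (eps ^+ q * b) + t * y) =
          t *: coords 1 (s / t) (b * eps + s / t) (y + s / t * (eps ^+ q * b)).
  by rewrite coordsZ; congr coords; field.
by rewrite vlineZ //; apply/BT_affine_pt/tr_along_cone_line.
Qed.

(** The norm condition on the point at infinity and the trace equation exclude
    m1 = 0; after translating the line to start at X1 = 0 and scaling its
    direction to m1 = 1, [normalised_line] applies. *)
Lemma affine_line_BT l : affine_line l -> contained_in l BT ->
  exists b y, [/\ Fq b, tr y = b ^+ sigma & l = cone_line b y].
Proof.
move=> [dl /negP/subvPn[v vl vinf]] /contained_inE lBT.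
have [x0 [y1 [y2 [y3 ev]]]] := vec_coords v.
rewrite ev mem_Pi_inf in vinf.
have [x1 [x2 [x3 pl]]] : exists x1 x2 x3, coords 1 x1 x2 x3 \in l.
  exists (x0^-1 * y1), (x0^-1 * y2), (x0^-1 * y3).
  by rewrite -[X in coords X](mulVf vinf) -coordsZ -ev memvZ.
set p := coords 1 x1 x2 x3 in pl.
have [u ul up] := line_other_point l p dl.
have [u0 [u1 [u2 [u3 eu]]]] := vec_coords u.
have eum : u - u0 *: p = coords 0 (u1 - u0 * x1) (u2 - u0 * x2) (u3 - u0 * x3).
  by rewrite eu -scaleNr coordsZ coordsD; congr coords; ring.
have [m1 [m2 [m3 [ml m_neq0]]]] : exists m1 m2 m3,
    coords 0 m1 m2 m3 \in l /\ coords 0 m1 m2 m3 != 0.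
  exists (u1 - u0 * x1), (u2 - u0 * x2), (u3 - u0 * x3); rewrite -eum.
  split; first by rewrite memvB // memvZ.
  by rewrite subr_eq0; apply: contraNneq up => ->; rewrite memvZ // memv_line.
have hm : m1 ^+ (q + 1) = m2 ^+ (q + 1).
  by apply/(BT_inf_pt _ _ _ m_neq0)/lBT.
have hp t : tr (x3 + t * m3)
            = Gamma q sigma eps (x1 + t * m1) + Gamma q sigma eps (x2 + t * m2).
  apply/BT_affine_pt.
  have -> : pt 1 (x1 + t * m1) (x2 + t * m2) (x3 + t * m3)
            = <[(p + t *: coords 0 m1 m2 m3)%R]>%VS.
    by rewrite coordsZ coordsD mulr0 addr0.
  apply: lBT; first by rewrite memvD // memvZ.
  apply/eqP; rewrite coordsZ coordsD mulr0 addr0 -coords0.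
  by move/coords_inj => [/eqP]; rewrite oner_eq0.
(* Otherwise moving by eps / m3 along the line changes tr X3 by tr eps = 1. *)
have m1_neq0 : m1 != 0.
  apply/eqP => m10; have m20 : m2 = 0.
    by move/eqP: hm; rewrite m10 addn1 expr0n eq_sym expf_eq0 => /eqP.
  have m3_neq0 : m3 != 0.
    by apply: contraNneq m_neq0 => m30; rewrite m10 m20 m30 coords0.
  have := hp (eps / m3); have := hp 0; rewrite m10 m20 !mulr0 mul0r !addr0 => <-.
  rewrite divfK // tr_add -[X in _ = X]addr0 => /addrI/eqP.
  by rewrite -[eps]mul1r -[1 * eps]add0r tr_coords ?oner_eq0 //; [exact: Fq0 | exact: Fq1].
pose y := x3 + x1 / m1 * m3.
(* The parameter (x1 + t) / m1 is the one at which X1 equals t. *)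
have [b [hb hw hx2 hm3 hy]] : exists b, [/\ Fq b, m2 / m1 = 1,
    x2 + x1 / m1 * m2 = b * eps, m3 / m1 = eps ^+ q * b & tr y = b ^+ sigma].
  apply: normalised_line => t; have := hp ((x1 + t) / m1).
  have -> : x1 + (x1 + t) / m1 * m1 = t.
    by apply: (eq_char2 _ _ x1); field.
  by rewrite /y => h; rewrite [X in tr X](_ : _ = x3 + (x1 + t) / m1 * m3);
    [rewrite h; congr (_ + Gamma _ _ _ _) | ]; field.
exists b, y; split => //.
apply: line_span => //.
- have -> : coords 0 1 1 (eps ^+ q * b) = m1^-1 *: coords 0 m1 m2 m3.
    by rewrite coordsZ mulr0 mulVf // -hw -hm3 !(mulrC m1^-1).
  by rewrite memvZ.
- have -> : coords 1 0 (b * eps) y = p + (x1 / m1) *: coords 0 m1 m2 m3.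
    rewrite coordsZ coordsD mulr0 addr0 divfK // hx2.
    by rewrite (addrr_pchar2 pchar2).
  by rewrite memvD // memvZ.
- by apply/eqP; rewrite -coords0 => /coords_inj[/eqP]; rewrite oner_eq0.
- apply/negP => /mem_pt[k /coords_inj[_ /eqP]].
  by rewrite mulr0 oner_eq0.
Qed.

Lemma cone_line_cap_l_inf b y : (cone_line b y :&: l_inf F)%VS = L_inf (eps ^+ q * b).
Proof.
apply/vspaceP => v; apply/memv_capP/mem_pt => [[/mem_cone_line[s [t ->]]] | [k ->]].
  rewrite mem_l_inf => /andP[/eqP-> _]; exists s.
  by rewrite !mul0r !addr0 mulr0 mulr1.
rewrite mulr0 mulr1 mem_l_inf eqxx (addrr_pchar2 pchar2) eqxx; split=> //.
by apply/mem_cone_line; exists k, 0; rewrite !mul0r !addr0.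
Qed.

Lemma e3_neq0 : coords 0 0 0 1 != 0 :> 'rV[F]_4.
Proof. by apply/eqP; rewrite -coords0 => /coords_inj[_ _ _ /eqP]; rewrite oner_eq0. Qed.

Lemma l_infE c : l_inf F = ((L_inf c)%R + (pt 0 0 0 1)%R)%VS.
Proof.
apply/vspaceP => v; have [v0 [v1 [v2 [v3 ->]]]] := vec_coords v.
rewrite mem_l_inf; apply/andP/mem_join_pt.
  move=> [/eqP-> /eqP/addr_eq0_char2->]; exists v2, (v3 - v2 * c).
  by congr coords; ring.
move=> [s [t /coords_inj[-> -> -> _]]].
by rewrite !mulr0 addr0 eqxx mulr1 addr0 (addrr_pchar2 pchar2).
Qed.

Lemma l_inf_line : pg_line (l_inf F).
Proof.
rewrite /pg_line (l_infE 0); apply: dim_span2; first exact: e3_neq0.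
by apply/negP => /mem_pt[k /coords_inj[_ /eqP]]; rewrite mulr0 oner_eq0.
Qed.

Lemma l_inf_BT : contained_in (l_inf F) BT.
Proof.
apply/contained_inE => v; have [v0 [v1 [v2 [v3 ->]]]] := vec_coords v.
by rewrite mem_l_inf => /andP[/eqP-> /eqP/addr_eq0_char2->] nz; apply/BT_inf_pt.
Qed.

(** A line at infinity through (0, 1, 1, c) that has a point with X1 <> X2 also
    contains a point (0, 0, X2, X3) with X2 <> 0, where the norm condition
    fails. *)
Lemma inf_line_BT l c : pg_line l -> (l <= Pi_inf F)%VS -> (L_inf c <= l)%VS ->
  contained_in l BT -> l = l_inf F.
Proof.
move=> dl linf; rewrite -memvE => Ll /contained_inE lBT.
have [u ul uL] := line_other_point l (coords 0 1 1 c) dl.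
have := subvP linf u ul; have [u0 [u1 [u2 [u3 eu]]]] := vec_coords u.
rewrite {1}eu mem_Pi_inf => /eqP u00; rewrite {}u00 in eu.
pose w := u - u1 *: coords 0 1 1 c.
have ew : w = coords 0 0 (u2 - u1) (u3 - u1 * c).
  by rewrite /w eu -scaleNr coordsZ coordsD; congr coords; ring.
have w0 : w != 0.
  by rewrite subr_eq0; apply: contraNneq uL => ->; rewrite memvZ // memv_line.
have wl : w \in l by rewrite memvB // memvZ.
have := lBT w wl w0; rewrite ew in w0 *.
move/(BT_inf_pt _ _ _ w0)/esym/eqP.
rewrite addn1 expr0n expf_eq0 subr_eq0 => /andP[_ /eqP e12].
apply/eqP; rewrite eqEdim l_inf_line dl leqnn andbT.
have L0 : coords 0 1 1 c != 0.
  by apply/eqP; rewrite -coords0 => /coords_inj[_ /eqP]; rewrite oner_eq0.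
rewrite (line_span _ _ _ dl ul Ll L0 uL) subv_add -!memvE eu !mem_l_inf eqxx.
by rewrite e12 !(addrr_pchar2 pchar2) eqxx.
Qed.

Lemma mem_L_inf_cone_line b y : coords 0 1 1 (eps ^+ q * b) \in cone_line b y.
Proof. by apply/mem_cone_line; exists 1, 0; rewrite !mul0r !addr0 mul1r. Qed.

Lemma mem_base_cone_line b y : coords 1 0 (b * eps) y \in cone_line b y.
Proof. by apply/mem_cone_line; exists 0, 1; rewrite !mul0r !mul1r !add0r. Qed.

Lemma cone_line_line b y : pg_line (cone_line b y).
Proof.
apply: dim_span2.
  by apply/eqP; rewrite -coords0 => /coords_inj[/eqP]; rewrite oner_eq0.
by apply/negP => /mem_pt[k /coords_inj[_ /eqP]]; rewrite mulr0 oner_eq0.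
Qed.

Lemma cone_line_affine b y : ~~ (cone_line b y <= Pi_inf F)%VS.
Proof.
apply/subvPn; exists (coords 1 0 (b * eps) y); first exact: mem_base_cone_line.
by rewrite mem_Pi_inf oner_eq0.
Qed.

Lemma cone_line_inj b : injective (cone_line b).
Proof.
move=> y y' E; have := mem_base_cone_line b y; rewrite E.
case/mem_cone_line=> s [t /coords_inj[<- <- _]].
by rewrite mul0r mul1r add0r.
Qed.

Lemma lines_through_L_inf b l : Fq b ->
  [/\ pg_line l, (L_inf (eps ^+ q * b)%R <= l)%VS & contained_in l BT] <->
  l = l_inf F \/ exists2 y, tr y = b ^+ sigma & l = cone_line b y.
Proof.
move=> hb; split=> [[dl Ll lBT] | [-> | [y hy ->]]].
- have [linf | laff] := boolP (l <= Pi_inf F)%VS.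
    by left; apply: inf_line_BT Ll lBT.
  have [|b' [y [hb' hy el]]] := affine_line_BT l _ lBT; first by split=> //; apply/negP.
  have eb : b = b'.
    have : coords 0 1 1 (eps ^+ q * b) \in cone_line b' y by rewrite -el memvE.
    case/mem_cone_line => s [t /coords_inj[<- <- _]].
    rewrite mul1r mul0r addr0; apply: mulfI.
    by rewrite expf_eq0 (negPf eps_neq0) andbF.
  by right; exists y; rewrite eb.
- split; [exact: l_inf_line | | exact: l_inf_BT].
  by rewrite -memvE mem_l_inf eqxx (addrr_pchar2 pchar2) eqxx.
- split; [exact: cone_line_line | | exact: cone_line_BT].
  by rewrite -memvE mem_L_inf_cone_line.
Qed.

Lemma cone_lines_seq b : Fq b ->
  let s := l_inf F :: [seq cone_line b y | y <- enum [pred y : F | tr y == b ^+ sigma]] in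
  [/\ uniq s, size s = (q + 1)%N &
      forall l, l \in s <-> l = l_inf F \/ exists2 y, tr y = b ^+ sigma & l = cone_line b y].
Proof.
move=> hb /=; split.
- rewrite (map_inj_uniq (cone_line_inj b)) enum_uniq andbT.
  apply/mapP => -[y _ E]; have := cone_line_affine b y.
  by rewrite -E capvSl.
- by rewrite size_map -cardE card_tr_fibre ?addn1 //; exact: FqX.
move=> l; rewrite inE; split.
  case/orP => [/eqP->|/mapP[y]]; first by left.
  by rewrite mem_enum => /eqP hy ->; right; exists y.
case=> [->|[y hy ->]]; first by rewrite eqxx.
by apply/orP; right; apply/map_f; rewrite mem_enum; apply/eqP.
Qed.

(** * The Hermitian cone *)

Definition base_frame (b : F) : 'M[F]_(2, 4) :=
  \matrix_(i < 2) if i == 0 then coords 1 0 (b * eps) 0 else coords 0 0 0 1.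

Definition base_line (b : F) : {vspace 'rV[F]_4} :=
  ((pt 1 0 (b * eps) 0)%R + (pt 0 0 0 1)%R)%VS.

(** The matrix of b ^ sigma u0 ^ (q + 1) + u1 u0 ^ q + u0 u1 ^ q, which for
    u0 = 1 vanishes exactly when tr u1 = b ^ sigma. *)
Definition base_form (b : F) : 'M[F]_2 :=
  \matrix_(i < 2, j < 2) if i == 0 then if j == 0 then b ^+ sigma else 1
                         else if j == 0 then 1 else 0.

Definition base_points (b : F) : pointset F := fun P =>
  exists u : 'rV[F]_2,
    [/\ u != 0, P = <[u *m base_frame b]>%VS
      & u *m base_form b *m (map_mx (fun x : F => x ^+ q) u)^T = 0].

Lemma base_line_line b : pg_line (base_line b).
Proof.
apply: dim_span2; first exact: e3_neq0.
by apply/negP => /mem_pt[k /coords_inj[/eqP]]; rewrite mulr0 oner_eq0.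
Qed.

Lemma base_hermitian b : Fq b -> hermitian_variety1 q (base_line b) (base_points b).
Proof.
move=> hb; exists (base_frame b), (base_form b); split => //.
- by rewrite basisEdim base_line_line span_cons span_seq1 !rowK subvv.
- apply/is_hermitianmxP; rewrite expr0 scale1r; apply/matrixP => i j.
  rewrite !mxE; have hs : (b ^+ sigma) ^+ q = b ^+ sigma by exact: FqX.
  by case: i j => [[|[|i]] hi] [[|[|j]] hj] //=; rewrite ?hs ?expr1n // expr0n eqn0Ngt q_gt0.
- pose H' : 'M[F]_2 :=
    \matrix_(i < 2, j < 2) if i == 0 then if j == 0 then 0 else 1
                         else if j == 0 then 1 else b ^+ sigma.
  have : base_form b *m H' = 1%:M.
    apply/matrixP => i j; rewrite !mxE !big_ord_recl big_ord0 !mxE /=.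
    case: i j => [[|[|i]] hi] [[|[|j]] hj] //=;
      rewrite ?(mul0r, mulr0, mul1r, mulr1, addr0, add0r) //.
    by rewrite (addrr_pchar2 pchar2).
  by case/mulmx1_unit.
Qed.

(** An isotropic point with u0 = 0 is (0, 0, 0, 1); otherwise dividing the form
    by u0 ^ (q + 1) turns isotropy into the trace equation for u1 / u0. *)
Lemma base_pointsP b P : Fq b ->
  base_points b P <->
  P = pt 0 0 0 1 \/ exists2 y, tr y = b ^+ sigma & P = pt 1 0 (b * eps) y.
Proof.
move=> hb.
have frameE (u : 'rV[F]_2) : u *m base_frame b
    = coords (u 0 0) 0 (u 0 0 * (b * eps)) (u 0 1).
  rewrite mulmx_sum_row !big_ord_recl big_ord0 !rowK /= addr0 !coordsZ coordsD.
  by rewrite !mulr0 !mulr1 !addr0 add0r; congr coords; congr (u _ _); apply: val_inj.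
have formE (u : 'rV[F]_2) :
    (u *m base_form b *m (map_mx (fun x : F => x ^+ q) u)^T == 0)
    = (b ^+ sigma * u 0 0 ^+ (q + 1) + u 0 1 * u 0 0 ^+ q + u 0 0 * u 0 1 ^+ q == 0).
  rewrite exprD expr1.
  transitivity ((u *m base_form b *m (map_mx (fun x : F => x ^+ q) u)^T) 0 0 == 0).
    apply/eqP/eqP => [-> | h]; first by rewrite mxE.
    by apply/matrixP => i j; rewrite !ord1 h mxE.
  rewrite !mxE !big_ord_recl !big_ord0 !mxE !big_ord_recl !big_ord0 !mxE /=.
  rewrite (_ : lift 0 0 = 1); last exact: val_inj.
  by congr (_ == 0); ring.
split=> [[u [u0 -> /eqP]] | [-> | [y hy ->]]].
- rewrite formE frameE => /eqP hu.
  have [a0 | a0] := eqVneq (u 0 0) 0.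
    have c0 : u 0 1 != 0.
      apply: contraNneq u0 => c0; apply/eqP/rowP => i; rewrite mxE.
      by case: i => [[|[|i]] hi] //; [rewrite -[RHS]a0 | rewrite -[RHS]c0];
        congr (u _ _); apply: val_inj.
    left; rewrite a0 mul0r /pt -(vlineZ _ (coords 0 0 0 1) c0) coordsZ.
    by rewrite !mulr0 mulr1.
  right; exists (u 0 1 / u 0 0); last first.
    rewrite /pt -(vlineZ _ (coords 1 _ _ _) a0) coordsZ mulr1 mulr0.
    by rewrite [u 0 0 * (_ / _)]mulrC divfK.
  apply: addr_eq0_char2; move: hu; rewrite exprMn exprVn addn1 exprS.
  have aq : u 0 0 ^+ q != 0 by rewrite expf_neq0.
  move=> hu; apply: (mulIf (mulf_neq0 a0 aq)).
  by rewrite mul0r -[RHS]hu; field; rewrite a0.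
- exists (\row_j (j == 1)%:R); split.
  + by apply/eqP => /rowP/(_ 1); rewrite !mxE => /eqP; rewrite oner_eq0.
  + by rewrite frameE !mxE /= mul0r.
  + by apply/eqP; rewrite formE !mxE /= addn1 !expr0n /= eqn0Ngt q_gt0 !mulr0 mul0r !addr0.
- exists (\row_j if j == 0 then 1 else y); split.
  + by apply/eqP => /rowP/(_ 0); rewrite !mxE => /eqP; rewrite oner_eq0.
  + by rewrite frameE !mxE /= mul1r.
  + apply/eqP; rewrite formE !mxE /= !expr1n !mulr1 mul1r -hy.
    by apply/eqP; apply: (eq_char2 _ _ (tr y)); ring.
Qed.

(** The lines are the joins of the vertex to the points of the base, l_inf coming
    from the base point (0, 0, 0, 1). *)
Lemma cone_hermitian b (s : seq {vspace 'rV[F]_4}) : Fq b ->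
    (forall l, l \in s <->
       l = l_inf F \/ exists2 y, tr y = b ^+ sigma & l = cone_line b y) ->
  exists p, [/\ pg_plane p, forall l, l \in s -> (l <= p)%VS
    & hermitian_cone q p (L_inf (eps ^+ q * b)) (points_on s)].
Proof.
move=> hb hs; pose V : {vspace 'rV[F]_4} := L_inf (eps ^+ q * b).
have hl l : l \in s <-> exists2 P, base_points b P & l = (V + P)%VS.
  split=> [/hs[-> | [y hy ->]] | [P /(base_pointsP _ _ hb)[-> | [y hy ->]] ->]].
  - by exists (pt 0 0 0 1); [apply/base_pointsP => //; left | exact: l_infE].
  - by exists (pt 1 0 (b * eps) y) => //; apply/base_pointsP => //; right; exists y.
  - by apply/hs; left; rewrite (l_infE (eps ^+ q * b)).
  - by apply/hs; right; exists y.
have Pm P : base_points b P -> (P <= base_line b)%VS.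
  case/(base_pointsP _ _ hb) => [-> | [y _ ->]]; first exact: addvSr.
  rewrite -memvE; apply/mem_join_pt; exists 1, y.
  by congr coords; ring.
have VNm : coords 0 1 1 (eps ^+ q * b) \notin base_line b.
  apply/negP => /mem_join_pt[k [t /coords_inj[_ /eqP]]].
  by rewrite !mulr0 addr0 oner_eq0.
exists (V + base_line b)%VS; split.
- by rewrite /pg_plane dim_add_vline // base_line_line.
- by move=> l /hl[P /Pm hP ->]; apply: addvS.
split.
- by rewrite /pg_plane dim_add_vline // base_line_line.
- rewrite /pg_point dim_vline; case: eqP VNm => // ->.
  by rewrite mem0v.
- exact: addvSl.
exists (base_line b), (base_points b); split.
- exact: base_line_line.
- exact: addvSr.
- by rewrite -memvE; apply/negP.
- exact: base_hermitian.
move=> P hP; split=> [[_ [l [/hl[B hB ->] hPl]]] | [B [hB hPB]]]; first by exists B.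
by split=> //; exists (V + B)%VS; split=> //; apply/hl; exists B.
Qed.

End Field.

Theorem theorem4p3 (F : finFieldType) (e q sigma : nat) (eps delta : F)
    (he3 : (3 <= e)%N) (he_odd : odd e)
    (hq : q = (2 ^ e)%N) (hsigma : sigma = (2 ^ ((e + 1) %/ 2))%N)
    (hF : #|F| = (q ^ 2)%N)
    (heps : ~ in_Fq q eps)
    (heps_eq : eps ^+ 2 + eps + delta = 0)
    (hdelta : in_Fq q delta) (hdelta1 : delta <> 1)
    (htr : abs_trace e delta = 1) :
  (forall l : {vspace 'rV[F]_4},
     affine_line l -> contained_in l (BT_quasi_hermitian q sigma eps) ->
     exists alpha : F,
       in_Fq q alpha /\ (l :&: l_inf F)%VS = L_inf (eps ^+ q * alpha))
  /\
  (forall alpha : F, in_Fq q alpha ->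
     exists s : seq {vspace 'rV[F]_4},
       [/\ uniq s,
           size s = (q + 1)%N,
           forall l : {vspace 'rV[F]_4},
             l \in s <->
             [/\ pg_line l, (L_inf (eps ^+ q * alpha)%R <= l)%VS
               & contained_in l (BT_quasi_hermitian q sigma eps)],
           l_inf F \in s
         & exists p : {vspace 'rV[F]_4},
             [/\ pg_plane p,
                 forall l : {vspace 'rV[F]_4}, l \in s -> (l <= p)%VS
               & hermitian_cone q p (L_inf (eps ^+ q * alpha))
                   (points_on s)]]).
Proof.
split=> [l laff lBT | alpha halpha].
  have [b [y [hb _ ->]]] := affine_line_BT F e q sigma eps delta he3 he_odd hq
    hsigma hF heps heps_eq hdelta l laff lBT.
  by exists b; split=> //; apply: cone_line_cap_l_inf hq hF b y.
have [us ss hs] := cone_lines_seq F e q sigma eps delta hq hF heps heps_eq hdelta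
  alpha halpha.
set s := (_ :: _) in us ss hs; exists s; split=> //.
- move=> l; rewrite hs; apply: iff_sym.
  exact: (lines_through_L_inf F e q sigma eps delta).
- exact: mem_head.
by apply: (cone_hermitian F e q sigma eps) hs.
Qed.
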